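(* $\mathscr{G}(2,0)=\{T_2\}$ (up to isomorphism), where $T_2$ is the tree with a vertex $u$ of degree $3$, each neighbour of $u$ of degree $2$, and all remaining vertices of degree $1$ (i.e. the tree on $7$ vertices obtained by joining a vertex to an end of each of three disjoint paths on two vertices).
   Context: Graphs are finite, simple and undirected; eigenvalues are those of the adjacency matrix. An eigenvalue of $G$ is main if it has an eigenvector with nonzero entry sum. For integers $a,b$, $\mathscr{G}(a,b)$ is the set of connected graphs with exactly two main eigenvalues satisfying $\sum_{u\in N(v)}d(u)=a\,d(v)+b$ for every vertex $v$. *)

(* Defs.v *)
From mathcomp Require Import all_boot all_order all_algebra.
From mathcomp Require Import reals.

Set Implicit Arguments.
Unset Strict Implicit.
Unset Printing Implicit Defensive.

Import Order.TTheory GRing.Theory Num.Theory.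
Local Open Scope ring_scope.

Record sgraph := SGraph {
  vertex :> finType;
  adj : rel vertex;
  adj_sym : symmetric adj;
  adj_irr : irreflexive adj
}.

Definition degree (G : sgraph) (v : G) : nat := #|[set u : G | adj v u]|.

Definition connected_graph (G : sgraph) : Prop :=
  (0 < #|G|)%N /\ forall x y : G, connect (@adj G) x y.

Definition isomorphic (G H : sgraph) : Prop :=
  exists2 f : G -> H, bijective f & forall x y : G, adj (f x) (f y) = adj x y.

(* Vertices are numbered by enum_val, so the index type is 'I_#|G|. *)
Definition adjacency_mx (R : realType) (G : sgraph) : 'M[R]_#|G| :=
  \matrix_(i, j) (adj (enum_val i) (enum_val j))%:R.

(* MathComp eigenspaces consist of row vectors; as the adjacency matrix is
   symmetric, these are the transposes of the usual column eigenvectors. *)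
Definition main_eigenvalue (R : realType) (G : sgraph) (l : R) : Prop :=
  eigenvalue (adjacency_mx R G) l /\
  exists2 x : 'rV[R]_#|G|,
    (x <= eigenspace (adjacency_mx R G) l)%MS & \sum_i x 0 i != 0.

Definition exactly_two_main_eigenvalues (R : realType) (G : sgraph) : Prop :=
  exists l1 l2 : R, l1 <> l2 /\
    forall l : R, main_eigenvalue G l <-> l = l1 \/ l = l2.

Definition scrG (R : realType) (a b : int) (G : sgraph) : Prop :=
  [/\ connected_graph G,
      exactly_two_main_eigenvalues R G
    & forall v : G,
        \sum_(u : G | adj v u) (degree u)%:Z = a * (degree v)%:Z + b].

(* None is the vertex of degree 3; the i-th path on two vertices has the end
   Some (i, false), which is joined to None, and the end Some (i, true). *)
Definition T2_adj : rel (option ('I_3 * bool)) := fun x y =>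
  match x, y with
  | None, None => false
  | None, Some (_, c) => ~~ c
  | Some (_, b), None => ~~ b
  | Some (i, b), Some (j, c) => (i == j) && (b != c)
  end.

Lemma T2_adj_sym : symmetric T2_adj.
Proof.
by move=> [[i b]|] [[j c]|] //=; rewrite eq_sym [b == c]eq_sym.
Qed.

Lemma T2_adj_irr : irreflexive T2_adj.
Proof. by move=> [[i b]|] //=; rewrite !eqxx. Qed.

Definition T2 : sgraph := SGraph T2_adj_sym T2_adj_irr.

(* Main.v *)
(** If every vertex [v] satisfies [\sum_(u in N(v)) d(u) = 2 d(v)], then
    [A 1 = d] and [A d = 2 d], so a main eigenvalue [l] satisfies [l^2 = 2 l];
    conversely [d] and [d - 2 1] are eigenvectors for [2] and [0].  Hence there
    are two main eigenvalues unless the graph is regular.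

    In a non-regular connected graph with this property some vertex is a leaf,
    as the degrees in a neighbourhood average to [2].  The neighbour of a leaf
    has degree [2], and its other neighbour [c] has degree [3].  Leaves being
    adjacent only to vertices of degree [2], all neighbours of [c] have degree
    exactly [2], and each of them has a leaf as its other neighbour.  This
    accounts for the whole component of [c], which is [T2]. *)
Require Import Defs.
From mathcomp Require Import all_boot all_order all_algebra.
From mathcomp Require Import reals zify ring.

Set Implicit Arguments.
Unset Strict Implicit.
Unset Printing Implicit Defensive.

Import Order.TTheory GRing.Theory Num.Theory.
Local Open Scope ring_scope.

(** The excesses [F u - k] are natural numbers with sum zero, so each vanishes. It is applied to a
    neighbourhood whose degrees average to 2. *)
Lemma sum_eq_lower_bound (T : finType) (A : {set T}) (F : T -> nat) (k : nat) :
  (forall u, u \in A -> k <= F u)%N -> (\sum_(u in A) F u = #|A| * k)%N ->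
  forall u, u \in A -> F u = k.
Proof.
move=> kF sumF u uA.
have : (\sum_(u in A) (F u - k) = 0)%N.
  rewrite sumnB; last by move=> i /kF.
  by rewrite sumF sum_nat_const subnn.
move/eqP; rewrite sum_nat_eq0 => /forallP/(_ u)/implyP/(_ uA) /eqP.
by have := kF u uA; lia.
Qed.

(** The degree condition of [scrG] for a = 2, b = 0, moved from integers to natural numbers. *)
Definition harmonic (G : sgraph) : Prop :=
  forall v : G, (\sum_(u : G | adj v u) degree u = degree v * 2)%N.

Lemma scrG_harmonic (R : realType) (G : sgraph) : scrG R 2 0 G -> harmonic G.
Proof.
move=> [_ _ hG] v; have := hG v.
by rewrite addr0 -(big_morph Posz PoszD (erefl _)) -PoszM mulnC => -[].
Qed.

(** * Local structure of graphs whose neighbourhood degrees average to 2 *)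

Section Neighbourhoods.
Variable G : sgraph.
Implicit Types u v w : G.

Definition nbhd v : {set G} := [set u | adj v u].

Lemma in_nbhd v u : (u \in nbhd v) = adj v u.
Proof. by rewrite inE. Qed.

Lemma adj_nbhd v u (A : {set G}) : nbhd v = A -> adj v u = (u \in A).
Proof. by move=> <-; rewrite in_nbhd. Qed.

Lemma harmonic_nbhd : harmonic G ->
  forall v, (\sum_(u in nbhd v) degree u = #|nbhd v| * 2)%N.
Proof. by move=> hG v; rewrite -hG; apply: eq_bigl => u; rewrite in_nbhd. Qed.

Lemma connected_closed (A : {set G}) : connected_graph G ->
  (forall u v, u \in A -> adj u v -> v \in A) ->
  forall v u, u \in A -> v \in A.
Proof.
move=> [_ conG] clA v u uA; have /connectP[p] := conG u v.
elim: p u uA => [|w p IH] u uA /=; first by move=> _ ->.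
by move=> /andP[uw pw]; apply: IH => //; apply: clA uw.
Qed.

Definition regular k := forall v, degree v = k.

(** An isolated vertex is closed under adjacency, so by connectedness it would be the whole graph,
    which is then 0-regular. *)
Lemma connected_degree_gt0 :
  connected_graph G -> ~ regular 0 -> forall v, (0 < degree v)%N.
Proof.
move=> conG nreg v; rewrite lt0n; apply/negP => /eqP dv; apply: nreg => w.
have clv x y : x \in [set v] -> adj x y -> y \in [set v].
  by move=> /set1P ->; rewrite -in_nbhd [nbhd v](cards0_eq dv) in_set0.
by have /set1P -> := connected_closed conG clv w (set11 v).
Qed.

Lemma degree1_nbhd u v : degree u = 1%N -> adj u v -> nbhd u = [set v].
Proof.
move=> /eqP/cards1P[w Nu] uv; move: (uv).
by rewrite -in_nbhd /nbhd Nu => /set1P ->.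
Qed.

Lemma degree2_nbhd u v : degree u = 2%N -> adj u v ->
  exists2 w, w != v & nbhd u = [set v; w].
Proof.
move=> du uv; have vN : v \in nbhd u by rewrite in_nbhd.
have : #|nbhd u :\ v| == 1%N by have := cardsD1 v (nbhd u); rewrite vN [LHS]du; lia.
move=> /cards1P[w Nw]; exists w; last by rewrite -Nw setD1K.
by have := set11 w; rewrite -Nw => /setD1P[].
Qed.

Hypotheses (conG : connected_graph G) (hG : harmonic G).

Lemma harmonic_leaf_nbr u v : degree u = 1%N -> adj u v -> degree v = 2%N.
Proof.
move=> du uv; have := harmonic_nbhd hG u.
by rewrite (degree1_nbhd du uv) big_set1 cards1.
Qed.

Lemma harmonic_degree2 u v : degree u = 2%N -> adj u v ->
  exists w, [/\ w != v, nbhd u = [set v; w] & (degree v + degree w = 4)%N].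
Proof.
move=> du uv; have [w wv Nu] := degree2_nbhd du uv; exists w; split=> //.
have := harmonic_nbhd hG u; rewrite Nu cards2 eq_sym wv.
by rewrite big_setU1 ?inE 1?eq_sym //= big_set1.
Qed.

Lemma harmonic_leaf : ~ regular 0 -> ~ regular 2 -> exists u : G, degree u = 1%N.
Proof.
move=> nreg0 nreg2; have dgt0 := connected_degree_gt0 conG nreg0.
case: (pickP (fun u : G => degree u == 1%N)) => [u /eqP|no1]; first by exists u.
(* Without leaves all degrees are at least 2, so in any neighbourhood the average 2 is attained
   everywhere. To reach [u], view it as a neighbour of one of its own neighbours [v]. *)
case: nreg2 => u; have /card_gt0P[v] := dgt0 u; rewrite -/(nbhd u) in_nbhd => uv.
apply: (sum_eq_lower_bound (A := nbhd v)); last by rewrite in_nbhd adj_sym.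
  by move=> w _; have := dgt0 w; have := no1 w; lia.
exact: harmonic_nbhd.
Qed.

Lemma harmonic_degree3 : ~ regular 0 -> ~ regular 2 -> exists c : G, degree c = 3%N.
Proof.
move=> nreg0 nreg2; have [u du] := harmonic_leaf nreg0 nreg2.
have /eqP/cards1P[v Nu] := du.
have uv : adj u v by rewrite -in_nbhd /nbhd Nu set11.
have vu : adj v u by rewrite adj_sym.
have [c [_ _ dc]] := harmonic_degree2 (harmonic_leaf_nbr du uv) vu.
by exists c; lia.
Qed.

(** A leaf next to [c] would force degree 2 on [c]. Hence all neighbours have degree at least 2, and
    their average 2 forces equality. *)
Lemma harmonic_degree3_nbr c v : ~ regular 0 ->
  degree c = 3%N -> adj c v -> degree v = 2%N.
Proof.
move=> nreg0 dc cv.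
apply: (sum_eq_lower_bound (A := nbhd c)); rewrite ?in_nbhd //; last exact: harmonic_nbhd.
move=> w; rewrite in_nbhd adj_sym => wc.
have := connected_degree_gt0 conG nreg0 w.
case: (ltngtP (degree w) 1%N) => [|//|/harmonic_leaf_nbr/(_ wc)]; lia.
Qed.

End Neighbourhoods.

(** * Recognising [T2] from its neighbourhoods *)

Lemma T2_nbhd (x : T2) : nbhd x = match x with
  | None => [set Some (i, false) | i : 'I_3]
  | Some (i, false) => [set None; Some (i, true)]
  | Some (i, true) => [set Some (i, false)]
  end.
Proof.
apply/setP => y; rewrite in_nbhd.
case: x y => [[i []]|] [[j []]|]; rewrite ?inE //=.
- by apply/esym/imsetP => -[].
- by apply/esym/imsetP; exists j.
- by apply/esym/imsetP => -[].
Qed.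

(** Since whole neighbourhoods are carried over, the image of [g] is closed under adjacency, so
    connectedness makes [g] surjective; its inverse is the isomorphism. *)
Lemma T2_embedding_isomorphic (G : sgraph) (g : T2 -> G) : connected_graph G ->
  injective g -> (forall x, nbhd (g x) = g @: nbhd x) -> isomorphic G T2.
Proof.
move=> conG g_inj Ng.
have /fin_all_exists[f gf] : forall v : G, exists x, g x = v.
  move=> v; have : v \in codom g.
    have root : g None \in [set u in codom g] by rewrite inE codom_f.
    suff clg u w : u \in [set u in codom g] -> adj u w -> w \in [set u in codom g].
      by have := connected_closed conG clg v root; rewrite inE.
    rewrite !inE => /codomP[x ->]; rewrite -in_nbhd Ng => /imsetP[y _ ->].
    exact: codom_f.
  by move=> /codomP[x ->]; exists x.
exists f; first by exists g => // x; apply: g_inj; rewrite gf.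
by move=> x y; rewrite -{2}(gf x) -{2}(gf y) -[RHS]in_nbhd Ng mem_imset // in_nbhd.
Qed.

Lemma harmonic_isomorphic (G : sgraph) : connected_graph G -> harmonic G ->
  (forall k, ~ regular G k) -> isomorphic G T2.
Proof.
move=> conG hG nreg.
have [c dc] := harmonic_degree3 conG hG (nreg 0%N) (nreg 2%N).
(* [degree c] is by definition the size of the neighbourhood of [c], so [dc] turns ['I_3] into the
   index type of its enumeration. *)
pose m (i : 'I_3) : G := enum_val (cast_ord (esym dc) i).
have m_inj : injective m by move=> i j /enum_val_inj/cast_ord_inj.
have cm i : adj c (m i) by have := enum_valP (cast_ord (esym dc) i); rewrite inE.
have dm i : degree (m i) = 2%N by apply: harmonic_degree3_nbr (cm i).
have Nc : nbhd c = m @: 'I_3.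
  apply/esym/eqP; rewrite eqEcard card_imset // card_ord [X in (X <= _)%N]dc leqnn andbT.
  by apply/subsetP => _ /imsetP[i _ ->]; rewrite in_nbhd.
have /fin_all_exists[l lP] : forall i, exists w,
    nbhd (m i) = [set c; w] /\ degree w = 1%N.
  move=> i; have mc : adj (m i) c by rewrite adj_sym.
  have [w [_ Nm dw]] := harmonic_degree2 hG (dm i) mc.
  by exists w; split=> //; lia.
have Nm i : nbhd (m i) = [set c; l i] by have [] := lP i.
have dl i : degree (l i) = 1%N by have [] := lP i.
have Nl i : nbhd (l i) = [set m i].
  by apply: degree1_nbhd => //; rewrite adj_sym (adj_nbhd _ (Nm i)) set22.
have l_inj : injective l.
  by move=> i j lij; apply/m_inj/set1P; rewrite -Nl -lij Nl set11.
pose g (x : T2) := match x with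
  | None => c | Some (i, false) => m i | Some (i, true) => l i end.
apply: (@T2_embedding_isomorphic _ g) => //.
  (* The degrees 3, 2 and 1 separate the three kinds of vertices; within a kind, injectivity of [l]
     or [m] applies. *)
  move=> [[i []]|] [[j []]|] //= E;
    try by have := congr1 (@degree G) E; rewrite ?dc ?dm ?dl.
    by rewrite (l_inj _ _ E).
  by rewrite (m_inj _ _ E).
move=> x; rewrite T2_nbhd; case: x => [[i []]|].
- by rewrite imset_set1 -[RHS]Nl.
- by rewrite imsetU1 imset_set1 -[RHS]Nm.
- by rewrite -imset_comp -[RHS]Nc.
Qed.

(** * Main eigenvalues of regular and of harmonic graphs *)

Section MainEigenvalues.
Variables (R : realType) (G : sgraph).
Local Notation A := (adjacency_mx R G).

(** Lets eigenvectors be treated as functions on the vertices, free of the numbering by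
    [enum_val]. *)
Definition row_of (f : G -> R) : 'rV[R]_#|G| := \row_i f (enum_val i).

Lemma sum_row_of (f : G -> R) : \sum_i row_of f 0 i = \sum_v f v.
Proof.
rewrite [RHS](reindex (@enum_val G G)) /=; last first.
  by apply: onW_bij; apply: enum_val_bij.
by apply: eq_bigr => i _; rewrite mxE.
Qed.

Lemma row_ofK (x : 'rV[R]_#|G|) : x = row_of (fun v => x 0 (enum_rank v)).
Proof. by apply/rowP => i; rewrite mxE enum_valK. Qed.

Lemma row_of_mul_adjacency (f : G -> R) :
  row_of f *m A = row_of (fun v => \sum_(u | adj v u) f u).
Proof.
apply/rowP => j; rewrite !mxE.
rewrite [RHS]big_mkcond /= [RHS](reindex (@enum_val G G)) /=; last first.
  by apply: onW_bij; apply: enum_val_bij.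
apply: eq_bigr => i _; rewrite !mxE adj_sym.
by case: ifP => _; rewrite ?mulr1 ?mulr0.
Qed.

Lemma main_eigenvalueP (l : R) :
  main_eigenvalue G l <->
  exists2 f : G -> R, (forall v, \sum_(u | adj v u) f u = l * f v)
                    & \sum_v f v != 0.
Proof.
split=> [[_ [x /eigenspaceP xA sx]]|[f fA sf]].
  rewrite (row_ofK x) sum_row_of in sx; exists (fun v => x 0 (enum_rank v)) => // v.
  move: xA; rewrite {1 2}(row_ofK x) row_of_mul_adjacency.
  by move/rowP/(_ (enum_rank v)); rewrite !mxE !enum_rankK.
have fE : (row_of f <= eigenspace A l)%MS.
  apply/eigenspaceP; rewrite row_of_mul_adjacency.
  by apply/rowP => i; rewrite !mxE fA.
rewrite -sum_row_of in sf; split; last by exists (row_of f).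
apply/eigenvalueP; exists (row_of f); first exact/eigenspaceP.
by apply: contraNneq sf => ->; rewrite big1 // => i _; rewrite mxE.
Qed.

(** The adjacency operator is self-adjoint, because adjacency is symmetric. *)
Lemma sum_adj_sum (f h : G -> R) :
  \sum_v (\sum_(u | adj v u) f u) * h v = \sum_v f v * (\sum_(u | adj v u) h u).
Proof.
under eq_bigr do rewrite big_distrl /= big_mkcond /=.
rewrite exchange_big /=; apply: eq_bigr => u _.
rewrite big_distrr [RHS]big_mkcond /=; apply: eq_bigr => v _.
by rewrite adj_sym.
Qed.

Lemma sum_adj1 (v : G) : \sum_(u | adj v u) (1 : R) = (degree v)%:R.
Proof. by rewrite sumr_const /degree cardsE. Qed.

(** Self-adjointness against the all-ones function, which the adjacency operator sends to the degree
    function. *)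
Lemma sum_adj_eigen (f : G -> R) (l : R) :
  (forall v, \sum_(u | adj v u) f u = l * f v) ->
  \sum_v f v * (degree v)%:R = l * \sum_v f v.
Proof.
move=> fA; under eq_bigr do rewrite -sum_adj1.
rewrite -sum_adj_sum mulr_sumr; apply: eq_bigr => v _.
by rewrite mulr1 fA.
Qed.

(** With constant degree k, [sum_adj_eigen] reads k s = l s for the entry sum s of an eigenvector;
    as s is nonzero for a main eigenvalue, k is the only candidate. *)
Lemma regular_not_two_main k :
  regular G k -> ~ exactly_two_main_eigenvalues R G.
Proof.
move=> reg [l1 [l2 [l12 mainE]]].
suff lk (l : R) : main_eigenvalue G l -> l = k%:R.
  have m1 : main_eigenvalue G l1 by apply/mainE; left.
  have m2 : main_eigenvalue G l2 by apply/mainE; right.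
  exact: l12 (etrans (lk _ m1) (esym (lk _ m2))).
move=> /main_eigenvalueP[f /sum_adj_eigen fA sf]; apply/(mulIf sf); rewrite -fA.
by rewrite mulr_sumr; apply: eq_bigr => v _; rewrite reg mulrC.
Qed.

Hypothesis hG : harmonic G.

Lemma harmonic_sum_degree (v : G) :
  \sum_(u | adj v u) (degree u)%:R = 2 * (degree v)%:R :> R.
Proof. by rewrite -natr_sum hG natrM mulrC. Qed.

Lemma harmonic_main_eigenvalue (l : R) :
  main_eigenvalue G l -> l = 0 \/ l = 2.
Proof.
move=> /main_eigenvalueP[f fA sf].
(* The pairing of A f with d is computed twice, by moving A onto d and by using that f is an
   eigenvector. Since f paired with d is l times the entry sum of f, the factor l (l - 2) must
   vanish. *)
have E : \sum_v (\sum_(u | adj v u) f u) * (degree v)%:R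
       = 2 * \sum_v f v * (degree v)%:R.
  rewrite sum_adj_sum mulr_sumr; apply: eq_bigr => v _.
  by rewrite harmonic_sum_degree; ring.
have E' : \sum_v (\sum_(u | adj v u) f u) * (degree v)%:R
        = l * \sum_v f v * (degree v)%:R.
  by rewrite mulr_sumr; apply: eq_bigr => v _; rewrite fA mulrA.
have : l * (l - 2) * \sum_v f v = 0.
  have -> : l * (l - 2) * \sum_v f v = (l - 2) * (l * \sum_v f v) by ring.
  by rewrite -(sum_adj_eigen fA) mulrBl -E -E' subrr.
move/eqP; rewrite mulf_eq0 (negbTE sf) orbF mulf_eq0 subr_eq0.
by case/orP => /eqP; [left|right].
Qed.

Lemma harmonic_main_eigenvalue2 : ~ regular G 0 -> main_eigenvalue G (2 : R).
Proof.
move=> nreg; apply/main_eigenvalueP.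
exists (fun v => (degree v)%:R); first exact: harmonic_sum_degree.
rewrite -natr_sum pnatr_eq0; apply/negP; rewrite sum_nat_eq0 => /forallP d0.
by apply: nreg => v; apply/eqP; have := d0 v.
Qed.

Lemma harmonic_main_eigenvalue0 : ~ regular G 2 -> main_eigenvalue G (0 : R).
Proof.
move=> nreg; apply/main_eigenvalueP; exists (fun v => (degree v)%:R - 2).
  move=> v; rewrite sumrB harmonic_sum_degree -[2%R in X in _ - X]mulr1 -mulr_sumr.
  by rewrite sum_adj1; ring.
apply/eqP => s0; apply: nreg => v.
(* The squared norm of [d - 2 1] is [-2] times its entry sum. *)
have dd : \sum_(v : G) ((degree v)%:R - 2 : R) ^+ 2
        = - 2 * \sum_(v : G) ((degree v)%:R - 2 : R).
  (* Pointwise (d - 2)^2 + 2 (d - 2) = d^2 - 2 d, and the right side sums to zero by [sum_adj_eigen]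
     for the eigenvector d with eigenvalue 2. *)
  have := sum_adj_eigen harmonic_sum_degree => /eqP; rewrite -subr_eq0 => /eqP E.
  apply/eqP; rewrite -subr_eq0; apply/eqP; rewrite -[RHS]E.
  by rewrite !mulr_sumr -!sumrB; apply: eq_bigr => u _; ring.
rewrite s0 mulr0 in dd.
move/eqP: dd; rewrite psumr_eq0; last by move=> u _; apply: sqr_ge0.
by move=> /allP/(_ v (mem_index_enum v)) /=; rewrite sqrf_eq0 subr_eq0 eqr_nat => /eqP.
Qed.

Lemma harmonic_two_main : ~ regular G 0 -> ~ regular G 2 ->
  exactly_two_main_eigenvalues R G.
Proof.
move=> nreg0 nreg2; exists 0, 2; split.
  by apply/eqP; rewrite eq_sym pnatr_eq0.
move=> l; split; first exact: harmonic_main_eigenvalue.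
by case=> ->; [apply: harmonic_main_eigenvalue0|apply: harmonic_main_eigenvalue2].
Qed.

End MainEigenvalues.

(** * Transfer of the relevant properties along isomorphisms *)

Section Isomorphism.
Variables (G H : sgraph).

Lemma isomorphic_connected :
  isomorphic G H -> connected_graph H -> connected_graph G.
Proof.
move=> [f [g fK gK] fadj] [H0 conH]; split.
  by have /card_gt0P[x _] := H0; apply/card_gt0P; exists (g x).
move=> x y; rewrite -(fK x) -(fK y).
have /connectP[p pth ->] := conH (f x) (f y).
apply/connectP; exists (map g p); last by rewrite last_map.
by move: pth; apply: homo_path => u v uv; rewrite -fadj !gK.
Qed.

Lemma isomorphic_degree (f : G -> H) : bijective f ->
  (forall x y, adj (f x) (f y) = adj x y) ->
  forall v, degree (f v) = degree v.
Proof.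
move=> [g fK gK] fadj v; rewrite /degree -(card_imset _ (can_inj fK)).
congr #|pred_of_set _|; apply/setP => u; rewrite inE -{1}(gK u) fadj.
by rewrite -{2}(gK u) mem_imset ?inE //; apply: can_inj fK.
Qed.

Lemma isomorphic_harmonic : isomorphic G H -> harmonic H -> harmonic G.
Proof.
move=> [f fbij fadj] hH v; rewrite -(isomorphic_degree fbij fadj) -hH.
rewrite (reindex f) /=; last exact: onW_bij.
by apply: eq_big => u; rewrite ?fadj // (isomorphic_degree fbij fadj).
Qed.

Lemma isomorphic_regular k : isomorphic G H -> regular G k -> regular H k.
Proof.
move=> [f [g fK gK] fadj] reg v.
by rewrite -(gK v) (isomorphic_degree _ fadj) //; exists g.
Qed.

End Isomorphism.

(** * Verification of these properties for [T2], and the conclusion *)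

Lemma T2_degree (x : T2) : degree x =
  match x with None => 3 | Some (_, false) => 2 | Some (_, true) => 1 end%N.
Proof.
rewrite /degree -/(nbhd x) T2_nbhd; case: x => [[i []]|].
- by rewrite cards1.
- by rewrite cards2.
- by rewrite card_imset ?card_ord // => i j [].
Qed.

Lemma T2_harmonic : harmonic T2.
Proof.
move=> x; under eq_bigl do rewrite -in_nbhd.
rewrite T2_nbhd T2_degree; case: x => [[i []]|].
- by rewrite big_set1 T2_degree.
- by rewrite big_setU1 ?inE //= big_set1 !T2_degree.
- rewrite big_imset /=; last by move=> i j _ _ [].
  by under eq_bigr do rewrite T2_degree; rewrite sum_nat_const card_ord.
Qed.

Lemma T2_not_regular k : ~ regular T2 k.
Proof.
move=> reg; have := reg None; have := reg (Some (ord0, true)).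
by rewrite !T2_degree => <-.
Qed.

Lemma T2_connected : connected_graph T2.
Proof.
have to_root x : connect (@adj T2) x None.
  case: x => [[i b]|]; last exact: connect0.
  have mid : connect (@adj T2) (Some (i, false)) None by apply: connect1.
  case: b => //; apply: connect_trans mid.
  by apply: connect1; rewrite /= eqxx.
split; first by apply/card_gt0P; exists None.
move=> x y; apply: connect_trans (to_root x) _.
by rewrite (sym_connect_sym (@adj_sym T2)).
Qed.

Theorem theorem4p1 (R : realType) (G : sgraph) :
  scrG R 2 0 G <-> isomorphic G T2.
Proof.
split=> [sG|iso].
  have [conG two _] := sG.
  apply: harmonic_isomorphic (scrG_harmonic sG) _ => // k reg.
  exact: regular_not_two_main reg two.
have hG := isomorphic_harmonic iso T2_harmonic.
have nreg k : ~ regular G k by move/(isomorphic_regular iso)/T2_not_regular.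
split; first exact: isomorphic_connected iso T2_connected.
  exact: harmonic_two_main.
by move=> v; rewrite addr0 -(big_morph Posz PoszD (erefl _)) hG mulnC PoszM.
Qed.
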